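(* Let $G$ be a free abelian group of finite rank $k\ge 1$, identified with $\mathbb{Z}^k\subset\mathbb{R}^k$, and let $\mathcal{A}\subset G$ be an arbitrary finite generating set of $G$ with $\mathcal{A}=-\mathcal{A}$ and $0\notin\mathcal{A}$. Let $\Gamma=\mathrm{Cay}(G,\mathcal{A})$. Then there exists an integer $R(\mathcal{A})$ such that for every integer $r\ge R(\mathcal{A})$, every automorphism $\phi$ of the graph $B_r$ is linear (i.e. there is a non-degenerate linear map $T:\mathbb{R}^k\to\mathbb{R}^k$ with $\phi(x)=T(x)$ for all $x\in V(B_r)$) and has a unique extension to an automorphism of $\Gamma$ fixing $0$.
   Context: $\Gamma=\mathrm{Cay}(G,\mathcal{A})$ has vertex set $G$ and edges $\{x,x+a\}$, $x\in G$, $a\in\mathcal{A}$. For $x\in G$, $\rho(x)$ denotes the length of a shortest path in $\Gamma$ from $0$ to $x$. For an integer $r\ge 0$, $B_r$ is the subgraph of $\Gamma$ induced by $\{x\in G:\rho(x)\le r\}$. *)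

(* Defs.v *)
From HB Require Import structures.
From mathcomp Require Import all_boot all_order all_algebra.
From mathcomp Require Import finmap all_classical reals.

Set Implicit Arguments.
Unset Strict Implicit.
Unset Printing Implicit Defensive.

Import GRing.Theory.
Local Open Scope classical_set_scope.
Local Open Scope ring_scope.

Record graph (T : choiceType) := Graph { vertices : set T; adj : rel T }.

Section Graphs.
Variables (T : choiceType) (X : graph T).

Definition is_path (x y : T) (p : seq T) : Prop :=
  [/\ {subset x :: p <= vertices X}, path (adj X) x p, uniq (x :: p)
    & last x p = y].

Definition path_length (x y : T) (n : nat) : Prop :=
  exists2 p, is_path x y p & size p = n.

(* Shortest-path length; the default 0 is only reached when no path joins x
   to y, which never happens in a connected graph. *)
Definition graph_dist (x y : T) : nat :=
  xget 0%N [set n | path_length x y n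
                    /\ forall m, path_length x y m -> (n <= m)%N].

Definition induced (S : set T) : graph T :=
  Graph (vertices X `&` S) (fun x y => [&& x \in S, y \in S & adj X x y]).

(* An automorphism of X is represented by a function on the ambient type T;
   only its values on the vertices of X matter. *)
Definition automorphism (f : T -> T) : Prop :=
  set_bij (vertices X) (vertices X) f /\
  {in vertices X &, forall x y, adj X (f x) (f y) = adj X x y}.

End Graphs.

Definition generates (G : zmodType) (A : {fset G}) : Prop :=
  forall H : {pred G}, zmod_closed H -> {subset A <= H} -> forall x, x \in H.

Section Cayley.
Variables (G : zmodType) (A : {fset G}).

(* x and y are adjacent iff {x, y} = {z, z + a} for some z in G, a in A. *)
Definition Cay : graph G :=
  Graph [set: G] (fun x y => has (fun a => (y == x + a) || (x == y + a)) A).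

Definition rho (x : G) : nat := graph_dist Cay 0 x.

Definition ball_graph (r : nat) : graph G :=
  induced Cay [set x | (rho x <= r)%N].

End Cayley.

(* The inclusion of Z^k into R^k. *)
Definition embed (R : realType) (k : nat) (x : 'rV[int]_k) : 'rV[R]_k :=
  map_mx intr x.

Definition linear_on (R : realType) (k : nat) (V : set 'rV[int]_k)
    (f : 'rV[int]_k -> 'rV[int]_k) : Prop :=
  exists T : {linear 'rV[R]_k -> 'rV[R]_k},
    bijective T /\ forall x, V x -> embed R (f x) = T (embed R x).

(* Main.v *)
(* An automorphism [f] of a large ball fixes the centre [0], the only vertex
   within distance [r] of the whole ball, hence preserves [rho].  Generators are
   treated by decreasing Euclidean norm: once [f (x + c) = f x + f c] is known
   for the longer [c], a generator [a] of maximal norm among the others is an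
   extreme point, so the two-step path [x, x + a, x + 2a] is the only one
   avoiding the longer generators and must go to a straight path.  Lines in
   direction [a] thus go to lines, and parallel lines, staying at bounded
   distance, get the same direction.  Each layer costs a bounded collar of the
   ball, so [f] is additive near [0] and agrees on [A] with an integral
   invertible matrix preserving [A].  Finally an automorphism is determined by
   its values on [A]: two vertices of the same sphere (of radius at least 2)
   with the same neighbours on the previous sphere are equal. *)

Require Import Defs.
From HB Require Import structures.
From mathcomp Require Import all_boot all_order all_algebra.
From mathcomp Require Import finmap all_classical reals.
From mathcomp Require Import zify.

Set Implicit Arguments.
Unset Strict Implicit.
Unset Printing Implicit Defensive.

Import GRing.Theory.
Local Open Scope ring_scope.

(** * Word length for a symmetric generating set *)

Section WordLength.
Variables (G : zmodType) (A : {fset G}).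
Hypothesis A_gen : generates A.
Hypothesis A_opp : forall a, a \in A -> - a \in A.

Lemma adj_CayE (x y : G) : adj (Cay A) x y = (y - x \in A).
Proof.
apply/hasP/idP => [[a aA /orP[] /eqP ->]|yxA].
- by rewrite addrC addKr.
- by rewrite opprD addNKr A_opp.
- by exists (y - x); rewrite ?(addrC x) ?subrK ?eqxx.
Qed.

(** Repeated vertices are allowed, unlike in [is_path], so that a walk can always be extended by a
    generator. *)
Definition walk (n : nat) (x : G) : Prop :=
  exists p, [/\ path (adj (Cay A)) 0 p, last 0 p = x & size p = n].

Lemma walk_step n x a : walk n x -> a \in A -> walk n.+1 (x + a).
Proof.
move=> [p [pp lp sp]] aA; exists (rcons p (x + a)).
rewrite rcons_path pp lp last_rcons size_rcons sp; split=> //.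
by rewrite adj_CayE addrC addKr.
Qed.

Lemma walk_exists x : exists n, walk n x.
Proof.
pose Q y := exists n, walk n y.
(* Ranging over all [z] and both signs makes [H] a subgroup. *)
pose H := [pred y | `[< forall z, Q z -> Q (z + y) /\ Q (z - y) >]].
have Q0 : Q 0 by exists 0%N, [::].
suff /asboolP /(_ 0 Q0)[] : x \in H by rewrite add0r.
apply: A_gen.
- split; first by apply/asboolP => z; rewrite subr0 addr0.
  move=> y y' /asboolP Hy /asboolP Hy'; apply/asboolP => z Qz; split.
    by rewrite addrA; apply: (Hy' _ _).2; apply: (Hy _ _).1.
  by rewrite opprB addrA; apply: (Hy _ _).2; apply: (Hy' _ _).1.
- move=> a aA; apply/asboolP => z [n wz].
  by split; exists n.+1; apply: walk_step => //; apply: A_opp.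
Qed.

Lemma walk_shorten n x :
  walk n x -> exists2 m, (m <= n)%N & path_length (Cay A) 0 x m.
Proof.
move=> [p [pp lp sp]]; case/shortenP: pp lp => p' pp' up' sub lp.
exists (size p'); last by exists p' => //; split=> // z _; rewrite inE.
by rewrite -sp; apply: uniq_leq_size => //; case/andP: up'.
Qed.

(** Connectedness keeps [graph_dist] away from its default value. *)
Lemma rho_spec x : path_length (Cay A) 0 x (rho A x) /\
  forall m, path_length (Cay A) 0 x m -> (rho A x <= m)%N.
Proof.
rewrite /rho /graph_dist; case: xgetP => [n _ //|none].
have [n /walk_shorten[m _ pm]] := walk_exists x.
have ex : exists m, `[< path_length (Cay A) 0 x m >] by exists m; apply/asboolP.
case: (ex_minnP ex) => l /asboolP pl minl.
case: (none l); split=> // i pi; apply: minl; exact/asboolP.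
Qed.

Lemma walk_rho x : walk (rho A x) x.
Proof. by have [[p [_ pp _ lp] sp] _] := rho_spec x; exists p. Qed.

Lemma rho_le_walk n x : walk n x -> (rho A x <= n)%N.
Proof. by case/walk_shorten => m mn /(rho_spec x).2 /leq_trans; apply. Qed.

Lemma rho0 : rho A 0 = 0%N.
Proof. by apply/eqP; rewrite -leqn0; apply: rho_le_walk; exists [::]. Qed.

Lemma rhoDgen x a : a \in A -> (rho A (x + a) <= (rho A x).+1)%N.
Proof. by move=> aA; apply/rho_le_walk/walk_step => //; apply: walk_rho. Qed.

Lemma rho_eq0 x : rho A x = 0%N -> x = 0.
Proof. by move=> r0; have := walk_rho x; rewrite r0 => -[[|y p] []]. Qed.

Lemma rho_pred x n : rho A x = n.+1 -> exists2 a, a \in A & rho A (x - a) = n.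
Proof.
move=> rx; have [p] := walk_rho x; rewrite rx.
case: p / (lastP p) => [[]//|p y [+ + [+]]].
rewrite rcons_path last_rcons size_rcons adj_CayE => /andP[pp lA] yx [sp].
rewrite yx in lA; exists (x - last 0 p) => //; rewrite subKr.
have le : (rho A (last 0%R p) <= n)%N by apply: rho_le_walk; exists p.
have := rhoDgen (last 0 p) lA; rewrite addrC subrK rx; lia.
Qed.

Lemma rho_ind (P : G -> Prop) : P 0 ->
  (forall x a, a \in A -> rho A (x + a) = (rho A x).+1 -> P x -> P (x + a)) ->
  forall x, P x.
Proof.
move=> P0 PS x; move en: (rho A x) => n.
elim: n x en => [x /rho_eq0 -> //|n IH x rx].
have [a aA ra] := rho_pred rx; rewrite -(subrK a x); apply: PS => //.
  by rewrite subrK rx ra.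
exact: IH.
Qed.

Lemma rhoD x y : (rho A (x + y) <= rho A x + rho A y)%N.
Proof.
elim/rho_ind: y => [|y a aA rya IH]; first by rewrite addr0 leq_addr.
by rewrite addrA rya addnS (leq_trans (rhoDgen _ aA)).
Qed.

Lemma rhoN x : rho A (- x) = rho A x.
Proof.
have le y : (rho A (- y) <= rho A y)%N.
  elim/rho_ind: y => [|y a aA rya IH]; first by rewrite oppr0.
  by rewrite rya opprD (leq_trans (rhoDgen _ (A_opp aA))).
by apply/eqP; rewrite eqn_leq le -{1}(opprK x) le.
Qed.

Lemma rho_mulrn x n : (rho A (x *+ n) <= n * rho A x)%N.
Proof.
elim: n => [|n IH]; first by rewrite mulr0n rho0.
by rewrite mulrS (leq_trans (rhoD _ _)) // mulSn leq_add2l.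
Qed.

Lemma rho_mulrz x (z : int) : (rho A (x *~ z) <= `|z|%N * rho A x)%N.
Proof.
case: z => n; first exact: rho_mulrn.
by rewrite NegzE mulrNz rhoN abszN; apply: rho_mulrn.
Qed.

Lemma rho_gen a : a \in A -> (rho A a <= 1)%N.
Proof. by move=> aA; rewrite -[a]add0r (leq_trans (rhoDgen _ aA)) // rho0. Qed.

Lemma rho_sum (I : Type) (s : seq I) (F : I -> G) :
  (rho A (\sum_(i <- s) F i) <= \sum_(i <- s) rho A (F i))%N.
Proof.
elim: s => [|i s IH]; first by rewrite !big_nil rho0.
by rewrite !big_cons (leq_trans (rhoD _ _)) // leq_add2l.
Qed.

(* [D] stands for the vertex set of a ball or of the whole Cayley graph. *)
Definition rho_closed (D : set G) : Prop :=
  forall x y, D x -> (rho A y <= rho A x)%N -> D y.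

(** * Adjacency-preserving maps and the distance to 0 *)

Section Isometries.
Variables (D : set G) (f : G -> G).
Hypothesis D_closed : rho_closed D.
Hypothesis f_bij : set_bij D D f.
Hypothesis f_adj : forall x y, D x -> D y -> (f y - f x \in A) = (y - x \in A).

(** [f 0] is left arbitrary, since [ball_aut0] uses this bound to prove [f 0 = 0]. *)
Lemma rho_aut_le x : D x -> (rho A (f x - f 0) <= rho A x)%N.
Proof.
elim/rho_ind: x => [|x a aA rxa IH] Dxa; first by rewrite subrr.
have Dx : D x by apply: D_closed Dxa _; rewrite rxa.
have fA : f (x + a) - f x \in A by rewrite f_adj // addrC addKr.
rewrite rxa -(subrK (f x) (f (x + a))) -addrA addrC.
by rewrite (leq_trans (rhoDgen _ fA)) // ltnS IH.
Qed.

Hypothesis f0 : f 0 = 0.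

Lemma rho_aut x : D x -> rho A (f x) = rho A x.
Proof.
case: f_bij => fD f_inj f_surj Dx.
have D0 : D 0 by apply: D_closed Dx _; rewrite rho0.
apply/eqP; rewrite eqn_leq; apply/andP; split.
  by have := rho_aut_le Dx; rewrite f0 subr0.
(* Conversely, a geodesic from 0 to [f x] stays in [D] and is pulled back edge by edge, by induction
   on the image [z]. *)
have [z] : exists z, z = f x by exists (f x).
have Dfx : D (f x) by apply: fD.
move=> zE; rewrite -zE in Dfx *.
elim/rho_ind: z x Dx zE Dfx => [|z a aA rza IH] x Dx zE Dza.
  by rewrite (f_inj x 0) ?inE ?rho0 ?f0.
have Dz : D z by apply: D_closed Dza _; rewrite rza.
have [y Dy yz] := f_surj _ Dz.
have yx : x - y \in A by rewrite -f_adj // -zE yz addrC addKr.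
have := rhoDgen y yx; rewrite addrC subrK rza => /leq_trans; apply.
by rewrite ltnS; apply: IH.
Qed.

End Isometries.

End WordLength.

(** * Norms on the integer lattice *)

Section Lattice.
Variable k : nat.
Implicit Types x y a v w : 'rV[int]_k.

Definition linf x : nat := \max_i `|x 0%R i|%N.
Definition sqnorm x : nat := \sum_i `|x 0%R i|%N ^ 2.

Lemma linf_ge x i : (`|x 0%R i|%N <= linf x)%N.
Proof. exact: (@leq_bigmax _ (fun i => `|x 0%R i|%N) i). Qed.

Lemma linf_eq0 x : linf x = 0%N -> x = 0.
Proof.
move=> x0; apply/rowP => i; rewrite mxE; apply/eqP.
by rewrite -absz_eq0 -leqn0; have := linf_ge x i; rewrite x0.
Qed.

Lemma linfD x y : (linf (x + y) <= linf x + linf y)%N.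
Proof.
apply/bigmax_leqP => i _; rewrite mxE.
by move: (linf_ge x i) (linf_ge y i) => /=; lia.
Qed.

Lemma linfN x : linf (- x) = linf x.
Proof. by apply: eq_bigr => i _; rewrite mxE abszN. Qed.

Lemma linf_mulrn x n : (n * linf x <= linf (x *+ n))%N.
Proof.
case: n => [|n]; first by rewrite mul0n.
rewrite mulnC -leq_divRL //; apply/bigmax_leqP => i _.
rewrite leq_divRL //; have := linf_ge (x *+ n.+1) i.
by rewrite mulmxnE -mulr_natr natz abszM.
Qed.

(** Takes the place of finiteness arguments: a nonempty bounded set stable under translation by [w]
    forces [w = 0]. *)
Lemma mulrn_bounded_eq0 y w B :
  (forall n, linf (y + w *+ n) <= B)%N -> w = 0.
Proof.
move=> bnd; apply: linf_eq0.
have := linf_mulrn w (B + linf y).+1.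
have := linfD (y + w *+ (B + linf y).+1) (- y); rewrite linfN addrC addKr.
have := bnd (B + linf y).+1; nia.
Qed.

Lemma sqnorm_eq0 x : sqnorm x = 0%N -> x = 0.
Proof.
move=> /eqP; rewrite sum_nat_eq0 => /forallP /= x0; apply/rowP => i.
by rewrite mxE; apply/eqP; have := x0 i; rewrite expn_eq0 andbT absz_eq0.
Qed.

Lemma sqnorm_parallelogram a v :
  (sqnorm (a + v) + sqnorm (a - v) = 2 * (sqnorm a + sqnorm v))%N.
Proof.
rewrite /sqnorm -!big_split big_distrr /=; apply: eq_bigr => i _; rewrite !mxE.
move: (a 0 i) (v 0 i) => p q; nia.
Qed.

(* The strict convexity of the Euclidean norm makes the longest vectors of a
   finite set extreme points. *)
Lemma sqnorm_midpoint a c d : c + d = a *+ 2 ->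
  (sqnorm c <= sqnorm a)%N -> (sqnorm d <= sqnorm a)%N -> c = a.
Proof.
move=> cd; have -> : d = a - (c - a).
  by rewrite opprB addrA -mulr2n -cd addrAC subrr add0r.
have := sqnorm_parallelogram a (c - a).
rewrite [a + (c - a)]addrC subrK => eqn lc ld.
have v0 : sqnorm (c - a) = 0%N by lia.
exact/subr0_eq/sqnorm_eq0.
Qed.

(** * Word length on the lattice and rigidity of automorphisms *)

Variable A : {fset 'rV[int]_k}.
Hypothesis A_gen : generates A.
Hypothesis A_opp : forall a, a \in A -> - a \in A.

Definition linf_max : nat := \max_(a <- A) linf a.

Lemma linf_gen a : a \in A -> (linf a <= linf_max)%N.
Proof. by move=> aA; rewrite /linf_max (big_rem a) //= leq_maxl. Qed.

Lemma linf_rho x : (linf x <= linf_max * rho A x)%N.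
Proof.
elim/(rho_ind A_gen A_opp): x => [|x a aA -> IH].
  by apply/bigmax_leqP => i _; rewrite mxE.
by rewrite mulnS (leq_trans (linfD _ _)) // addnC leq_add // linf_gen.
Qed.

(* For [s > 0] and [rho x = s + 1] put [U x = {a in A | rho (x - a) = s}].
   The hypothesis says [U x' = U x + (x' - x)], while commutativity
   gives [U x \subset U x']: the finite set [U x] is stable under the translation
   by [x - x']. *)
Lemma rho_twin x x' s : rho A x = s.+2 -> rho A x' = s.+2 ->
  (forall y, rho A y = s.+1 -> (x - y \in A) = (x' - y \in A)) -> x = x'.
Proof.
move=> rx rx' tw; pose w := x - x'.
have pred_rho z a : rho A z = s.+2 -> a \in A -> (rho A (z - a) <= s.+1)%N ->
    rho A (z - a) = s.+1.
  by move=> rz aA; have := rhoDgen A_gen A_opp (z - a) aA; rewrite subrK rz; lia.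
have Ustep a : a \in A -> rho A (x - a) = s.+1 ->
    a + w \in A /\ rho A (x - (a + w)) = s.+1.
  move=> aA ra; have [b bA rb] := rho_pred A_gen A_opp ra.
  have rxb : rho A (x - b) = s.+1.
    apply: pred_rho => //; have := rhoDgen A_gen A_opp (x - a - b) aA.
    by rewrite rb addrAC subrK.
  have bwA : b - w \in A.
    have -> : b - w = x' - (x - b) by rewrite /w !opprB addrCA.
    by rewrite -tw // subKr.
  have rx'a : rho A (x' - a) = s.+1.
    apply: pred_rho => //; have := rhoDgen A_gen A_opp (x - a - b) bwA.
    have -> : x - a - b + (b - w) = x' - a.
      by rewrite /w; apply/rowP => i; rewrite !mxE /=; lia.
    by rewrite rb.
  have xx : x - (x' - a) = a + w by rewrite opprB addrCA.
  split; first by rewrite -xx tw // subKr.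
  by rewrite -xx subKr.
have [a aA ra] := rho_pred A_gen A_opp rx.
have Un n : a + w *+ n \in A /\ rho A (x - (a + w *+ n)) = s.+1.
  elim: n => [|n [IHA IHr]]; first by rewrite mulr0n addr0.
  by rewrite mulrSr addrA; apply: Ustep.
apply: subr0_eq; apply: (@mulrn_bounded_eq0 a _ linf_max) => n.
by apply: linf_gen; have [] := Un n.
Qed.

(** [D] is the ball when an automorphism is compared with its matrix, and the whole group when two
    extensions are compared. *)
Lemma aut_eq (D : set 'rV[int]_k) (f g : 'rV[int]_k -> 'rV[int]_k) :
  rho_closed A D -> set_bij D D f -> set_bij D D g ->
  (forall x y, D x -> D y -> (f y - f x \in A) = (y - x \in A)) ->
  (forall x y, D x -> D y -> (g y - g x \in A) = (y - x \in A)) ->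
  f 0 = 0 -> g 0 = 0 -> (forall a, a \in A -> f a = g a) ->
  forall x, D x -> f x = g x.
Proof.
move=> D_closed f_bij g_bij f_adj g_adj f0 g0 fgA x.
have [n] := ubnP (rho A x); elim: n x => // n IH x lxn Dx.
(* Points of the sphere of radius 1 all have 0 as their only neighbour on the previous sphere; there
   agreement on [A] replaces [rho_twin]. *)
case rx : (rho A x) => [|[|s]].
- by rewrite (rho_eq0 A_gen A_opp rx) f0 g0.
- have [a aA /(rho_eq0 A_gen A_opp) /eqP] := rho_pred A_gen A_opp rx.
  by rewrite subr_eq0 => /eqP ->; apply: fgA.
have [fD _ _] := f_bij; have [_ _ g_surj] := g_bij.
(* [x'] lies on the sphere of [x] and, by induction, has the same neighbours on the previous one. *)
have [x' Dx' gx'] := g_surj _ (fD _ Dx).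
rewrite -gx'; congr (g _); apply/esym/(@rho_twin _ _ s) => // [|y ry].
  rewrite -(rho_aut A_gen A_opp D_closed g_bij g_adj g0 Dx') gx'.
  by rewrite (rho_aut A_gen A_opp D_closed f_bij f_adj f0 Dx).
have Dy : D y by apply: D_closed Dx _; rewrite rx ry.
by rewrite -(f_adj _ _ Dy Dx) -(g_adj _ _ Dy Dx') gx' (IH y) //; lia.
Qed.

(** * Automorphisms of a ball *)

Section BallAutomorphism.
Variables (r : nat) (f : 'rV[int]_k -> 'rV[int]_k).
Let D : set 'rV[int]_k := [set x | (rho A x <= r)%N]%classic.
Hypothesis f_bij : set_bij D D f.
Hypothesis f_adj : forall x y, D x -> D y -> (f y - f x \in A) = (y - x \in A).

Lemma ball_closed : rho_closed A D.
Proof. by move=> x y Dx lyx; apply: leq_trans Dx. Qed.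

(* Every vertex is within distance [r] of [f 0], so the ball is stable under the
   translation by [- f 0]. *)
Lemma ball_aut0 : f 0 = 0.
Proof.
case: f_bij => fD f_inj f_surj.
have step z : D z -> D (z - f 0).
  move=> /f_surj[x Dx <-]; apply: leq_trans (Dx).
  exact: (rho_aut_le A_gen A_opp ball_closed f_adj).
have Dn n : D (0 + (- f 0) *+ n).
  elim: n => [|n IH]; first by rewrite mulr0n addr0 /D /= (rho0 A_gen A_opp).
  by rewrite mulrSr addrA; apply: step.
apply/eqP; rewrite -oppr_eq0; apply/eqP.
apply: (@mulrn_bounded_eq0 0 _ (linf_max * r)) => n.
by rewrite (leq_trans (linf_rho _)) // leq_mul2l [(rho _ _ <= r)%N]Dn orbT.
Qed.

Let f0 := ball_aut0.

(** Collar lost per layer: room for the [2 * linf_max + 1] steps that [peel_parallel] takes from a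
    neighbour of [x]. *)
Definition peel_cost : nat := (2 * linf_max + 4)%N.

(** * One layer of generators of maximal remaining norm *)

Section Peeling.
Variables (peeled : pred 'rV[int]_k) (m : nat) (a : 'rV[int]_k).
Hypothesis f_peeled : forall c x, c \in A -> peeled c -> (rho A x + m <= r)%N ->
  f (x + c) = f x + f c.
Hypothesis aA : a \in A.
Hypothesis aD' : ~~ peeled a.
Hypothesis a_longest : forall c, c \in A -> ~~ peeled c -> (sqnorm c <= sqnorm a)%N.

Let rhoDgen x c : c \in A -> (rho A (x + c) <= (rho A x).+1)%N.
Proof. exact: rhoDgen. Qed.

(** Taking the two image steps in the opposite order gives another path from [f x] to [f (x + 2a)].
    Its preimage, through [z], avoids peeled generators, so [z = x + a] by [sqnorm_midpoint] and the
    two steps coincide. *)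
Lemma peel_second_difference x : (rho A x + m + 2 <= r)%N ->
  f (x + a *+ 2) - f (x + a) = f (x + a) - f x.
Proof.
case: f_bij => fD f_inj f_surj rx.
have injf u v : D u -> D v -> f u = f v -> u = v.
  by move=> Du Dv; apply: f_inj; rewrite inE.
have rx1 := rhoDgen x aA.
have rx2 : (rho A (x + a *+ 2) <= (rho A x).+2)%N.
  by rewrite mulr2n addrA (leq_trans (rhoDgen _ aA)).
have Dx : D x by rewrite /D /=; lia.
have Dx1 : D (x + a) by rewrite /D /=; lia.
have Dx2 : D (x + a *+ 2) by rewrite /D /=; lia.
have f1A : f (x + a) - f x \in A by rewrite f_adj // addrC addKr.
have f2A : f (x + a *+ 2) - f (x + a) \in A.
  by rewrite f_adj // mulr2n addrA [_ - _]addrC addKr.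
have rfx : rho A (f x) = rho A x.
  exact: (rho_aut A_gen A_opp ball_closed f_bij f_adj f0 Dx).
have [z Dz fz] : exists2 z, D z & f z = f x + (f (x + a *+ 2) - f (x + a)).
  have [] := f_surj (f x + (f (x + a *+ 2) - f (x + a)));
    last by move=> z; exists z.
  by rewrite /D /=; have := rhoDgen (f x) f2A; lia.
have cA : z - x \in A by rewrite -f_adj // fz addrC addKr.
have dA : x + a *+ 2 - z \in A.
  rewrite -f_adj // fz.
  suff -> : f (x + a *+ 2) - (f x + (f (x + a *+ 2) - f (x + a))) =
    f (x + a) - f x by [].
  by apply/rowP => i; rewrite !mxE /=; lia.
have rz : (rho A z <= (rho A x).+1)%N.
  by have := rhoDgen x cA; rewrite [x + _]addrC subrK.
(* If [c = z - x] were peeled, additivity at [x] and [x + a] would give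
   [f (x + a + c) = f (x + 2a)], hence [c = a]. *)
have cD' : ~~ peeled (z - x).
  apply: contra aD' => c'; suff -> : a = z - x by [].
  have rc := rhoDgen (x + a) cA.
  apply: (addrI (x + a)); rewrite -[x + a + a]addrA -mulr2n; apply: injf => //.
    by rewrite /D /= (leq_trans rc) //; lia.
  rewrite (f_peeled cA c'); last by lia.
  have := f_peeled cA c' (x := x); rewrite [x + _]addrC subrK fz.
  move=> /(_ _)/addrI <-; last by lia.
  by rewrite [RHS]addrC subrK.
have dD' : ~~ peeled (x + a *+ 2 - z).
  apply: contra aD' => d'; suff -> : a = x + a *+ 2 - z by [].
  have rd := rhoDgen x dA.
  apply: (addrI x); apply: injf => //.
    by rewrite /D /= (leq_trans rd) //; lia.
  rewrite (f_peeled dA d'); last by lia.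
  have e := f_peeled dA d' (x := z).
  rewrite [z + _]addrC subrK fz in e.
  apply: (addIr (f (x + a *+ 2) - f (x + a))).
  by rewrite [LHS]addrC subrK [RHS]addrAC; apply: e; lia.
have : z - x = a.
  apply: sqnorm_midpoint (a_longest cA cD') (a_longest dA dD').
  by rewrite [LHS]addrC addrA subrK [LHS]addrC addKr.
move=> /eqP; rewrite subr_eq [a + x]addrC => /eqP zE.
by rewrite -[in RHS]zE fz [RHS]addrC addKr.
Qed.

Lemma peel_line x n : (rho A x + m + n + 1 <= r)%N ->
  f (x + a *+ n) = f x + (f (x + a) - f x) *+ n.
Proof.
elim: n x => [|[|n] IH] x rx; first by rewrite !mulr0n !addr0.
  by rewrite !mulr1n [RHS]addrC subrK.
have rx1 := rhoDgen x aA.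
have {}IH : f (x + a + a *+ n.+1) = _ := IH (x + a) ltac:(lia).
rewrite mulrS addrA IH.
rewrite -addrA -mulr2n peel_second_difference; last by lia.
by rewrite [in RHS]mulrS addrA [f x + _]addrC subrK.
Qed.

(* Two parallel lines stay at distance 1, so their images have the same slope. *)
Lemma peel_parallel x c : c \in A -> (rho A x + m + peel_cost <= r)%N ->
  f (x + c + a) - f (x + c) = f (x + a) - f x.
Proof.
(* The images of the lines are one edge apart at both ends, so
   [n * linf (v - u) <= 2 * linf_max < n]. *)
move=> cA; rewrite /peel_cost => rx; set n := (2 * linf_max).+1.
have rc := rhoDgen x cA.
have rn : (rho A (a *+ n) <= n)%N.
  rewrite (leq_trans (rho_mulrn A_gen A_opp _ _)) // -[leqRHS]muln1 leq_mul2l.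
  by rewrite (rho_gen A_gen A_opp aA) orbT.
have Dn y : (rho A y + n <= r)%N -> D (y + a *+ n).
  by apply: leq_trans; rewrite (leq_trans (rhoD A_gen A_opp _ _)) // leq_add2l.
set v := f (x + c + a) - f (x + c); set u := f (x + a) - f x.
have lA : f (x + c + a *+ n) - f (x + a *+ n) \in A.
  rewrite f_adj; [|by apply: Dn; lia..].
  by rewrite [x + c + _]addrAC [_ - _]addrC addKr.
have kA : f (x + c) - f x \in A.
  by rewrite f_adj /D /=; [rewrite [_ - _]addrC addKr|lia..].
have e : (v - u) *+ n = f (x + c + a *+ n) - f (x + a *+ n) - (f (x + c) - f x).
  rewrite !peel_line; [|by lia..].
  rewrite mulrnBl -/v -/u.
  move: (v *+ n) (u *+ n) (f (x + c)) (f x) => p q y z.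
  by apply/rowP => i; rewrite !mxE /=; lia.
have l : (n * linf (v - u) <= linf_max + linf_max)%N.
  rewrite (leq_trans (linf_mulrn _ _)) // e (leq_trans (linfD _ _)) //.
  by rewrite linfN leq_add // linf_gen.
have vu0 : linf (v - u) = 0%N by rewrite /n in l; nia.
exact/subr0_eq/linf_eq0.
Qed.

(** The step in direction [a] is carried along a geodesic from 0 to [x], which stays in the smaller
    ball, so the collar is paid only once. *)
Lemma peel_additive x : (rho A x + m + peel_cost <= r)%N ->
  f (x + a) = f x + f a.
Proof.
move=> rx; suff e : f (x + a) - f x = f a by rewrite -e [RHS]addrC subrK.
elim/(rho_ind A_gen A_opp): x rx => [|x c cA rxc IH] rx.
  by rewrite f0 add0r subr0.
by rewrite peel_parallel ?IH //; lia.
Qed.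

End Peeling.

(** * Additivity near the origin *)

Definition sqnorm_max : nat := \max_(a <- A) sqnorm a.

Lemma sqnorm_gen a : a \in A -> (sqnorm a <= sqnorm_max)%N.
Proof. by move=> aA; rewrite /sqnorm_max (big_rem a) //= leq_maxl. Qed.

(** Layers are indexed by the integer [sqnorm]: stage 0 is empty, stage [sqnorm_max + 1] covers all
    of [A]. *)
Lemma peel_layers j a x : a \in A -> (sqnorm_max < sqnorm a + j)%N ->
  (rho A x + j * peel_cost <= r)%N -> f (x + a) = f x + f a.
Proof.
elim: j a x => [|j IH] a x aA; first by have := sqnorm_gen aA; lia.
move=> qa rx; have [qa'|qa'] := ltnP sqnorm_max (sqnorm a + j).
  by apply: IH => //; nia.
(* Here [sqnorm a = sqnorm_max - j], the largest value possible outside the earlier layers. *)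
apply: (@peel_additive (fun c => sqnorm_max < sqnorm c + j)%N
  (j * peel_cost)) => //.
- by rewrite /= -leqNgt.
- by move=> c cA; rewrite /= -leqNgt; lia.
- by rewrite mulSn in rx; lia.
Qed.

Definition additive_cost : nat := (sqnorm_max.+1 * peel_cost)%N.

Lemma ball_autD x y : (rho A x + rho A y + additive_cost <= r)%N ->
  f (x + y) = f x + f y.
Proof.
elim/(rho_ind A_gen A_opp): y => [|y a aA rya IH] rxy.
  by rewrite f0 !addr0.
have step z : (rho A z + additive_cost <= r)%N -> f (z + a) = f z + f a.
  by move=> rz; apply: (peel_layers (j := sqnorm_max.+1)) => //; lia.
rewrite rya in rxy; have rxy' : (rho A (x + y) + additive_cost <= r)%N.
  by rewrite (leq_trans (leq_add (rhoD A_gen A_opp x y) (leqnn _))) //; lia.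
by rewrite addrA (step (x + y)) // IH ?(step y) ?addrA //; lia.
Qed.

Lemma ball_autN x : (2 * rho A x + additive_cost <= r)%N -> f (- x) = - f x.
Proof.
move=> rx; apply: (addrI (f x)); rewrite -ball_autD ?subrr //.
by rewrite (rhoN A_gen A_opp); lia.
Qed.

Lemma ball_aut_mulrn x n : (n * rho A x + additive_cost <= r)%N ->
  f (x *+ n) = f x *+ n.
Proof.
elim: n => [|n IH] rx; first by rewrite !mulr0n.
rewrite !mulrS ball_autD ?IH //; first by rewrite mulSn in rx; lia.
rewrite (leq_trans _ rx) // leq_add2r mulSn leq_add2l.
exact: rho_mulrn.
Qed.

Lemma ball_autZ x (z : int) : (2 * `|z| * rho A x + additive_cost <= r)%N ->
  f (z *: x) = z *: f x.
Proof.
rewrite -[in f _](intz z) -[in RHS](intz z) !scaler_int.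
case: z => n rx; first by rewrite -!pmulrn ball_aut_mulrn //; nia.
rewrite NegzE !mulrNz; rewrite NegzE abszN /= in rx.
rewrite ball_autN ?ball_aut_mulrn //; first by nia.
apply: leq_trans rx; rewrite leq_add2r -mulnA leq_mul2l /=.
exact: rho_mulrn.
Qed.

Lemma ball_aut_sum (I : Type) (s : seq I) (F : I -> 'rV[int]_k) :
  (\sum_(i <- s) rho A (F i) + additive_cost <= r)%N ->
  f (\sum_(i <- s) F i) = \sum_(i <- s) f (F i).
Proof.
elim: s => [|i s IH]; first by rewrite !big_nil f0.
rewrite !big_cons => rs; rewrite ball_autD ?IH //; first by lia.
by rewrite (leq_trans _ rs) // leq_add2r leq_add2l rho_sum.
Qed.

(** The 1 puts [A] in the ball; the sum pays for expanding a generator in the standard basis, with a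
    factor 2 for negative coefficients ([ball_autN]). *)
Definition linear_radius : nat :=
  (1 + additive_cost + 2 * linf_max * \sum_(i < k) rho A (delta_mx 0%R i))%N.

(** * The integral matrix of a ball automorphism *)

Definition ball_mx : 'M[int]_k := \matrix_i f (delta_mx 0 i).

Hypothesis r_large : (linear_radius <= r)%N.

Lemma ball_mx_gen a : a \in A -> a *m ball_mx = f a.
Proof.
move=> aA; rewrite mulmx_sum_row [in RHS](row_sum_delta a).
have le i : (2 * `|a 0%R i| * rho A (delta_mx 0%R i) <=
             2 * linf_max * rho A (delta_mx 0%R i))%N.
  by rewrite leq_mul2r leq_mul2l (leq_trans (linf_ge _ _)) ?linf_gen ?orbT.
rewrite ball_aut_sum => [|].
  apply: eq_bigr => i _; rewrite rowK ball_autZ //.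
  apply: leq_trans r_large.
  rewrite /linear_radius addnC -addnA addnCA leq_add2l addnC.
  rewrite (bigD1 i) //= mulnDr; have := le i; lia.
apply: leq_trans r_large.
rewrite /linear_radius addnC leq_add ?leq_addl // big_distrr /=.
apply: leq_sum => i _; apply: leq_trans (le i).
rewrite -[a 0 i]intz scaler_int intz (leq_trans (rho_mulrz _ _ _ _)) //.
by nia.
Qed.

Let D_le1 a : a \in A -> D a.
Proof.
move=> aA; rewrite /D /= (leq_trans (rho_gen A_gen A_opp aA)) //.
by apply: leq_trans r_large.
Qed.

Let D0 : D 0. Proof. by rewrite /D /= (rho0 A_gen A_opp). Qed.

Lemma ball_aut_gen a : D a -> (f a \in A) = (a \in A).
Proof. by move=> Da; rewrite -[f a]subr0 -f0 f_adj // subr0. Qed.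

Lemma ball_mx_gen_surj b : b \in A -> exists2 a, a \in A & a *m ball_mx = b.
Proof.
move=> bA; case: f_bij => _ _ f_surj; have [a Da fa] := f_surj _ (D_le1 bA).
have aA : a \in A by rewrite -ball_aut_gen // fa.
by exists a; rewrite // ball_mx_gen.
Qed.

(** The image of the matrix is a subgroup containing [A], hence everything; preimages of the basis
    vectors form the rows of an inverse. *)
Lemma ball_mx_unit : ball_mx \in unitmx.
Proof.
have surj x : exists y, y *m ball_mx = x.
  pose H := [pred x | `[< exists y, y *m ball_mx = x >]].
  suff /asboolP : x \in H by [].
  apply: A_gen x; last first.
    by move=> b /ball_mx_gen_surj[a _ ab]; apply/asboolP; exists a.
  split; first by apply/asboolP; exists 0; rewrite mul0mx.
  move=> u v /asboolP[u' <-] /asboolP[v' <-]; apply/asboolP.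
  by exists (u' - v'); rewrite mulmxBl.
have [N NE] := choice surj.
suff /mulmx1_unit[] : (\matrix_i N (delta_mx 0 i)) *m ball_mx = 1%:M by [].
by apply/row_matrixP => i; rewrite row_mul rowK NE row1.
Qed.

Lemma gen_ball_mx x : (x *m ball_mx \in A) = (x \in A).
Proof.
apply/idP/idP => [/ball_mx_gen_surj[a aA]|xA].
  by move=> /(can_inj (mulmxK ball_mx_unit)) <-.
by rewrite ball_mx_gen // ball_aut_gen //; apply: D_le1.
Qed.

Let ball_map (x : 'rV[int]_k) : 'rV[int]_k := x *m ball_mx.

Lemma ball_mx_bij : set_bij setT setT ball_map.
Proof.
split=> // [x y _ _ /= /(can_inj (mulmxK ball_mx_unit)) //|y _].
by exists (y *m invmx ball_mx); rewrite // /ball_map mulmxKV ?ball_mx_unit.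
Qed.

Lemma ball_mx_adj x y : (y *m ball_mx - x *m ball_mx \in A) = (y - x \in A).
Proof. by rewrite -mulmxBl gen_ball_mx. Qed.

Lemma rho_ball_mx x : rho A (x *m ball_mx) = rho A x.
Proof.
apply: (rho_aut A_gen A_opp (D := setT) _ ball_mx_bij) => //; last exact: mul0mx.
by move=> u v _ _; apply: ball_mx_adj.
Qed.

(** Covers the collar, which additivity does not reach: the matrix preserves [rho], so it is itself
    an automorphism of the ball, and [aut_eq] applies. *)
Lemma ball_mxE x : D x -> f x = x *m ball_mx.
Proof.
apply: (aut_eq ball_closed f_bij (g := ball_map)) => //=.
- split=> [u|u v _ _ /= /(can_inj (mulmxK ball_mx_unit)) //|y Dy].
    by rewrite /D /= rho_ball_mx.
  exists (y *m invmx ball_mx); last by rewrite /ball_map mulmxKV ?ball_mx_unit.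
  by rewrite /D /= -rho_ball_mx mulmxKV ?ball_mx_unit.
- by move=> u v _ _; apply: ball_mx_adj.
- exact: mul0mx.
- by move=> a aA; rewrite /ball_map ball_mx_gen.
Qed.

End BallAutomorphism.
End Lattice.

(** * Linearity and unique extension *)

Theorem theorem2 (R : realType) (k : nat) (k_gt0 : (0 < k)%N)
    (A : {fset 'rV[int]_k}) (A_gen : generates A)
    (A_sym : A = [fset - a | a in A]%fset) (A_0 : 0 \notin A) :
  exists R_A : nat, forall r : nat, (R_A <= r)%N ->
    forall phi : 'rV[int]_k -> 'rV[int]_k,
      automorphism (ball_graph A r) phi ->
      linear_on R (vertices (ball_graph A r)) phi /\
      exists! psi : 'rV[int]_k -> 'rV[int]_k,
        [/\ automorphism (Cay A) psi, psi 0 = 0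
          & forall x, vertices (ball_graph A r) x -> psi x = phi x].
Proof.
have A_opp a : a \in A -> - a \in A.
  by move=> aA; rewrite A_sym; apply/imfsetP; exists a.
exists (linear_radius A) => r r_large phi.
rewrite /automorphism.
have -> : vertices (ball_graph A r) = [set x | (rho A x <= r)%N]%classic.
  by rewrite /= setTI.
set D := [set x | _]%classic => -[phi_bij phi_adj0].
have phi_adj x y : D x -> D y -> (phi y - phi x \in A) = (y - x \in A).
  move=> Dx Dy; have [phiD _ _] := phi_bij.
  have /= := phi_adj0 x y (mem_set Dx) (mem_set Dy).
  by rewrite -!(adj_CayE A_opp) !mem_set //; apply: phiD.
have phi0 := ball_aut0 A_gen A_opp phi_bij phi_adj.
have T_unit := ball_mx_unit A_gen A_opp phi_bij phi_adj r_large.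
have phiE := ball_mxE A_gen A_opp phi_bij phi_adj r_large.
have T_adj := ball_mx_adj A_gen A_opp phi_bij phi_adj r_large.
have T_bij := ball_mx_bij A_gen A_opp phi_bij phi_adj r_large.
set T := ball_mx phi in T_unit phiE T_adj T_bij.
split.
  exists (mulmxr (map_mx intr T)); split; last first.
    by move=> x Dx; rewrite /embed phiE //= map_mxM.
  exists (mulmxr (map_mx intr (invmx T))) => x /=;
    by rewrite -mulmxA -map_mxM ?mulmxV ?mulVmx // map_mx1 mulmx1.
exists (fun x => x *m T); split=> [|psi [[psi_bij psi_adj] psi0 psiE]].
  split; [split=> // x y _ _|exact: mul0mx|by move=> x Dx; rewrite phiE].
  by rewrite !(adj_CayE A_opp) T_adj.
apply/funext => x.
(* Both extensions agree on [A], which lies in the ball. *)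
apply: (@aut_eq _ A A_gen A_opp setT (fun x => x *m T) psi) => //.
- by move=> u v _ _; rewrite -!(adj_CayE A_opp) psi_adj ?inE.
- exact: mul0mx.
- move=> a aA; have Da : D a; last by rewrite psiE ?phiE.
  by apply: leq_trans (rho_gen A_gen A_opp aA) _; apply: leq_trans r_large.
Qed.
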